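(* Let $\Gamma$ be a set with weight function $w:\Gamma\to(0,\infty)$, and let $1<p<\infty$, $p\neq2$. Then there is no embedding (isomorphism onto a subspace) of $\ell^2$ into $m^{p,\infty}(\Gamma,w)$.
   Context: With $\mu(\sigma)=\sum_{\gamma\in\sigma}w(\gamma)$ on $\mathcal P(\Gamma)$, $\ell^{p,\infty}(\Gamma,w)$ is the space of functions $f$ on $\Gamma$ with $\|f\|=\sup_{c>0}c\,(\mu\{|f|>c\})^{1/p}<\infty$ (a Banach space under an equivalent norm), and $m^{p,\infty}(\Gamma,w)$ is its closed subspace generated by the characteristic functions of sets of finite $\mu$-measure. *)

(* Defs.v *)
From HB Require Import structures.
From mathcomp Require Import all_boot all_order all_algebra.
From mathcomp Require Import all_classical all_reals all_analysis.
Set Implicit Arguments. Unset Strict Implicit. Unset Printing Implicit Defensive.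
Import Order.TTheory GRing.Theory Num.Theory.
Local Open Scope classical_set_scope.
Local Open Scope ring_scope.

Definition wmu (R : realType) (G : choiceType) (w : G -> R) (A : set G) : \bar R :=
  \esum_(g in A) (w g)%:E.

Definition levset (R : realType) (G : choiceType) (f : G -> R) (c : R) : set G :=
  [set g | c < `|f g|].

Definition wknorm (R : realType) (G : choiceType) (w : G -> R) (p : R)
  (f : G -> R) : \bar R :=
  ereal_sup [set (c%:E * (wmu w (levset f c)) `^ p^-1)%E | c in [set c : R | 0 < c]].

Definition in_lpinf (R : realType) (G : choiceType) (w : G -> R) (p : R)
  (f : G -> R) : Prop := (wknorm w p f < +oo)%E.

Definition simple_fm (R : realType) (G : choiceType) (w : G -> R) (g : G -> R) : Prop :=
  exists (n : nat) (a : 'I_n -> R) (A : 'I_n -> set G),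
    (forall i, (wmu w (A i) < +oo)%E) /\
    g = (fun x => \sum_(i < n) a i * \1_(A i) x).

Definition in_mpinf (R : realType) (G : choiceType) (w : G -> R) (p : R)
  (f : G -> R) : Prop :=
  in_lpinf w p f /\
  forall eps : R, 0 < eps ->
    exists g, simple_fm w g /\ (wknorm w p (fun x => (f x - g x)%R) < eps%:E)%E.

Definition l2sq (R : realType) (x : nat -> R) : \bar R :=
  \esum_(k in [set: nat]) ((x k) ^+ 2)%:E.

Definition in_l2 (R : realType) (x : nat -> R) : Prop := (l2sq x < +oo)%E.

Definition l2norm (R : realType) (x : nat -> R) : R := Num.sqrt (fine (l2sq x)).

Definition embeds_l2_into_mpinf (R : realType) (G : choiceType) (w : G -> R) (p : R) : Prop :=
  exists (T : (nat -> R) -> (G -> R)) (a b : R),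
    0 < a /\ 0 < b /\
    (forall (r : R) (x y : nat -> R), in_l2 x -> in_l2 y ->
        T (fun k => r * x k + y k) = (fun g => r * T x g + T y g)) /\
    (forall x, in_l2 x -> in_mpinf w p (T x)) /\
    (forall x, in_l2 x ->
        ((a * l2norm x)%:E <= wknorm w p (T x))%E /\
        (wknorm w p (T x) <= (b * l2norm x)%:E)%E).

(* Main.v *)
(* Let x_n be the image of the n-th unit vector. Finitely supported functions are
   dense in m^{p,oo}, because a set of finite measure is finite up to a set of
   small measure, and x_n tends to 0 pointwise, because evaluations are bounded
   functionals. A gliding hump thus makes sums of k of the x_n close to sums of
   disjoint finite blocks, while their norm must be of order sqrt k.
   If p > 2, the norm of a sum of k disjoint blocks is at most of order k^{1/p}.
   If p < 2, either mu{|x_n| > c} >= delta for fixed c, delta and infinitely many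
   n, which makes the norm at least of order k^{1/p}; or mu{|x_n| > c} -> 0 for
   every c > 0, and then the blocks can be taken to live at essentially different
   levels, so that their sums are bounded as in c_0. *)
Require Import Defs.
From mathcomp Require Import all_boot all_order all_algebra.
From mathcomp Require Import all_classical all_reals all_analysis.
From mathcomp Require Import ring lra.
Import Order.TTheory GRing.Theory Num.Theory.
Local Open Scope ring_scope.

(** Dividing by [k ^ s] bounds [k ^ (q - s)], which is refuted at the first integer above [M]. Each
    case of the main argument ends here, with different exponents. *)
Lemma powR_growth {R : realType} (s q C1 C2 : R) : s < q -> 0 < C1 ->
  (forall k : nat, (0 < k)%N -> C1 * k%:R `^ q <= C2 * k%:R `^ s) -> False.
Proof.
move=> sq C10 H; have d0 : 0 < q - s by rewrite subr_gt0.
set M := (`|C2| / C1 + 1) `^ (q - s)^-1.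
have M0 : 0 <= M by exact: powR_ge0.
set k := (Num.truncn M).+1.
have Mk : M < k%:R by exact: truncnS_gt.
have k0 : 0 < k%:R :> R by rewrite ltr0n.
have := H k isT.
have -> : q = (q - s) + s by ring.
rewrite powRD; last by rewrite (gt_eqF k0) implybT.
rewrite mulrA ler_pM2r ?powR_gt0// => le.
have : M `^ (q - s) < k%:R `^ (q - s).
  by rewrite gt0_ltr_powR ?nnegrE// ltW.
have n0 : 0 <= `|C2| / C1 by rewrite divr_ge0// ltW.
rewrite -powRrM mulVf ?gt_eqF// powRr1 ?addr_ge0// => lt.
have : C1 * (`|C2| / C1 + 1) < C2.
  by apply: lt_le_trans le; rewrite ltr_pM2l.
have -> : C1 * (`|C2| / C1 + 1) = `|C2| + C1 by field; rewrite gt_eqF.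
by have := ler_norm C2; lra.
Qed.

(* The inequality [wknorm w p f <= K `^ p^-1]; additive in [K] for disjointly
   supported functions. *)
Definition weak_bound {R : realType} {G : choiceType} (w : G -> R) (p : R)
    (f : G -> R) (K : R) : Prop :=
  forall c, 0 < c -> (wmu w (levset f c) <= (K / c `^ p)%:E)%E.

Definition cutoff {R : realType} {G : choiceType} (D : set G) (f : G -> R) :
  G -> R := fun g => if g \in D then f g else 0.

(** * Measures of level sets and the calculus of weak-type bounds *)

Section Weak.
Local Set Implicit Arguments. Local Unset Strict Implicit.
Local Open Scope classical_set_scope.
Context {R : realType} {G : choiceType} {w : G -> R}.
Hypothesis hw : forall g, 0 < w g.

Lemma wmu_ge0 (A : set G) : (0 <= wmu w A)%E.
Proof. by apply: esum_ge0 => g _; rewrite lee_fin ltW. Qed.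

Lemma wmuID (A B : set G) :
  (wmu w A = wmu w (A `&` B) + wmu w (A `&` ~` B))%E.
Proof. by apply: esumID => g _; rewrite lee_fin ltW. Qed.

Lemma le_wmu (A B : set G) : A `<=` B -> (wmu w A <= wmu w B)%E.
Proof. by move=> AB; rewrite (wmuID B A) (setIidr AB) leeDl// wmu_ge0. Qed.

Lemma wmuU (A B : set G) : A `&` B = set0 ->
  (wmu w (A `|` B) = wmu w A + wmu w B)%E.
Proof.
move=> AB0; rewrite (wmuID _ A) setUK; congr (_ + wmu w _)%E.
rewrite setIUl setICr set0U; apply/setIidl => g Bg Ag.
by have : (A `&` B) g by []; rewrite AB0.
Qed.

Lemma wmuU_le (A B : set G) : (wmu w (A `|` B) <= wmu w A + wmu w B)%E.
Proof.
rewrite (wmuID _ A) setUK leeD// le_wmu// => g [[Ag|//] nAg].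
by case: (nAg Ag).
Qed.

Lemma wmu_finite (A : set G) : finite_set A -> (wmu w A < +oo)%E.
Proof.
move=> fA; rewrite /wmu esum_fset//; last by move=> g _; rewrite lee_fin ltW.
by rewrite fsbig_finite//= sumEFin ltry.
Qed.

(** [esum] is the supremum of the finite partial sums; one of them comes within [eta] of the finite
    total. *)
Lemma wmu_finite_approx (A : set G) (eta : R) : (wmu w A < +oo)%E -> 0 < eta ->
  exists2 H : set G, finite_set H & (wmu w (A `&` ~` H) <= eta%:E)%E.
Proof.
move=> Afin eta0.
have Afn : wmu w A \is a fin_num by rewrite ge0_fin_numE ?wmu_ge0.
have [_ [X [finX XA] <-]] := ub_ereal_sup_adherent eta0 Afn.
rewrite -esum_fset//; last by move=> g _; rewrite lee_fin ltW.
rewrite -/(wmu w X) -[ereal_sup _]/(wmu w A) => ltX; exists X => //.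
move: Afn ltX; rewrite (wmuID A X) (setIidr XA).
have := wmu_ge0 (A `&` ~` X); have := wmu_ge0 X.
case: (wmu w X) => [u| |]//; case: (wmu w (A `&` ~` X)) => [v| |]//.
by rewrite !lee_fin -EFinD -EFinN -EFinD lte_fin => *; lra.
Qed.

Lemma cutoff_in (D : set G) (f : G -> R) g : D g -> cutoff D f g = f g.
Proof. by move=> Dg; rewrite /cutoff mem_set. Qed.

Lemma cutoff_out (D : set G) (f : G -> R) g : ~ D g -> cutoff D f g = 0.
Proof. by move=> Dg; rewrite /cutoff memNset. Qed.

Lemma cutoffC_add (D : set G) (f : G -> R) :
  (fun g => cutoff D f g + cutoff (~` D) f g) = f.
Proof.
apply/funext => g; have [Dg|nDg] := pselect (D g).
  by rewrite cutoff_in// cutoff_out// addr0.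
by rewrite cutoff_out// cutoff_in// add0r.
Qed.

Lemma levset_cutoff (D : set G) (f : G -> R) c : 0 < c ->
  levset (cutoff D f) c = levset f c `&` D.
Proof.
move=> c0; apply/seteqP; split => g; rewrite /levset/=.
  have [Dg|nDg] := pselect (D g); first by rewrite cutoff_in.
  by rewrite cutoff_out// normr0 ltNge ltW.
by move=> [? ?]; rewrite cutoff_in.
Qed.

Lemma levset_disjointU (f h : G -> R) c : 0 < c -> (forall g, f g = 0 \/ h g = 0) ->
  levset (fun g => f g + h g) c = levset f c `|` levset h c /\
  levset f c `&` levset h c = set0.
Proof.
move=> c0 fh; have n0 : ~ (c < `|0 : R|) by rewrite normr0 ltNge ltW.
split; apply/seteqP; split => g; rewrite /levset/=; have [->|->] := fh g;
  rewrite ?add0r ?addr0; tauto.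
Qed.

Lemma wmu_levset_disjoint (f h : G -> R) c : 0 < c ->
  (forall g, f g = 0 \/ h g = 0) ->
  (wmu w (levset (fun g => f g + h g)%R c) =
   wmu w (levset f c) + wmu w (levset h c))%E.
Proof. by move=> c0 fh; have [-> /wmuU] := levset_disjointU c0 fh. Qed.

Section WeakBound.
Context {p : R}.
Hypothesis p0 : 0 < p.

Lemma weak_bound_le (f h : G -> R) K L : (forall g, `|f g| <= `|h g|) -> K <= L ->
  weak_bound w p h K -> weak_bound w p f L.
Proof.
move=> fh KL hK c c0; apply: (@le_trans _ _ (K / c `^ p)%:E).
  by apply: le_trans (hK c c0); apply: le_wmu => g /= /lt_le_trans; apply.
by rewrite lee_fin ler_pM2r// invr_gt0 powR_gt0.
Qed.

Lemma weak_bound_levsetU (f h k : G -> R) K L :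
  (forall c, 0 < c -> levset f c `<=` levset h c `|` levset k c) ->
  weak_bound w p h K -> weak_bound w p k L -> weak_bound w p f (K + L).
Proof.
move=> sub hK kL c c0.
apply: le_trans (le_wmu (sub c c0)) _; apply: le_trans (wmuU_le _ _) _.
by rewrite mulrDl EFinD leeD ?hK ?kL.
Qed.

(** Where the sum exceeds [c], one summand exceeds [c / 2]; halving the level costs the factor
    [2 ^ p]. *)
Lemma weak_boundD (f h : G -> R) K L :
  weak_bound w p f K -> weak_bound w p h L ->
  weak_bound w p (fun g => f g + h g) (2 `^ p * (K + L)).
Proof.
move=> fK hL c c0; have c20 : 0 < c / 2 by rewrite divr_gt0.
have sub : levset (fun g => f g + h g) c `<=`
    levset f (c / 2) `|` levset h (c / 2).
  move=> g; rewrite /levset/= => cfh.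
  have [?|le1] := ltP (c / 2) `|f g|; first by left.
  right; rewrite ltNge; apply/negP => le2.
  by have := ler_normD (f g) (h g); lra.
apply: le_trans (le_wmu sub) _; apply: le_trans (wmuU_le _ _) _.
have -> : 2 `^ p * (K + L) / c `^ p = K / (c / 2) `^ p + L / (c / 2) `^ p.
  have cE : c `^ p = (c / 2) `^ p * 2 `^ p.
    by rewrite -powRM ?ltW//; congr (_ `^ _); field.
  rewrite cE; field.
  by rewrite !gt_eqF ?powR_gt0.
by rewrite EFinD leeD ?fK ?hL.
Qed.

(** Level sets lie in [A] when [c < M] and are empty when [M <= c]. *)
Lemma weak_bound_bounded (f : G -> R) (A : set G) (M eta : R) :
  (forall g, `|f g| <= M) -> (forall g, ~ A g -> f g = 0) ->
  (wmu w A <= eta%:E)%E -> weak_bound w p f (M `^ p * eta).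
Proof.
move=> fM fA muA c c0.
have eta0 : 0 <= eta by rewrite -lee_fin; apply: le_trans muA; exact: wmu_ge0.
have [cM|Mc] := ltP c M.
  have sub : levset f c `<=` A.
    move=> g; rewrite /levset/= => cf; apply: contrapT => /fA fg0.
    by move: cf; rewrite fg0 normr0 ltNge ltW.
  apply: le_trans (le_wmu sub) _; apply: le_trans muA _.
  rewrite lee_fin ler_pdivlMr ?powR_gt0// mulrC ler_wpM2r//.
  by rewrite ge0_ler_powR ?nnegrE// ltW// (lt_trans c0).
have -> : levset f c = set0.
  apply/seteqP; split => g //; rewrite /levset/= => cf.
  by have := lt_le_trans cf (le_trans (fM g) Mc); rewrite ltxx.
by rewrite /wmu esum_set0 lee_fin divr_ge0 ?mulr_ge0 ?powR_ge0.
Qed.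

Lemma wknorm_weak_bound (f : G -> R) (K : R) : 0 <= K ->
  (wknorm w p f <= K%:E)%E <-> weak_bound w p f (K `^ p).
Proof.
move=> K0; have pV0 : 0 < p^-1 by rewrite invr_gt0.
have key c : 0 < c ->
    ((c%:E * wmu w (levset f c) `^ p^-1 <= K%:E) =
     (wmu w (levset f c) <= (K `^ p / c `^ p)%:E))%E.
  move=> c0; have := wmu_ge0 (levset f c).
  case: (wmu w (levset f c)) => [d| |]// d0; last first.
    (* On a level set of infinite measure both inequalities fail. *)
    by rewrite poweRyr ?gt_eqF// mulry gtr0_sg// mul1e.
  rewrite poweR_EFin -EFinM !lee_fin ler_pdivlMr ?powR_gt0//.
  rewrite lee_fin in d0.
  have -> : d * c `^ p = (c * d `^ p^-1) `^ p.
    rewrite powRM ?powR_ge0// ?ltW// -powRrM mulVf ?gt_eqF// powRr1//.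
    by rewrite mulrC.
  apply/idP/idP => H.
    by rewrite ge0_ler_powR ?nnegrE ?mulr_ge0 ?powR_ge0// ltW.
  rewrite leNgt; apply/negP => Kc.
  by move: H; rewrite leNgt gt0_ltr_powR ?nnegrE ?mulr_ge0 ?powR_ge0// ltW.
split => [H c c0|H].
  rewrite -key//; apply: le_trans H; apply: ereal_sup_ubound.
  by exists c.
by apply: ge_ereal_sup => _ [c c0 <-]; rewrite key//; exact: H.
Qed.

End WeakBound.
End Weak.

(** * Tails of elements of [m^{p,oo}] and bounded evaluations *)

Section Simple.
Local Set Implicit Arguments. Local Unset Strict Implicit.
Local Open Scope classical_set_scope.
Context {R : realType} {G : choiceType} {w : G -> R} {p : R}.
Hypothesis hw : forall g, 0 < w g.
Hypothesis p0 : 0 < p.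

Lemma simple_fm_bounded (f : G -> R) : simple_fm w f ->
  exists M (A : set G), [/\ 0 <= M, forall g, `|f g| <= M,
    forall g, ~ A g -> f g = 0 & (wmu w A < +oo)%E].
Proof.
case=> n [a [A [Afin ->]]].
exists (\sum_(i < n) `|a i|), (\big[setU/set0]_(i < n) A i); split.
- exact: sumr_ge0.
- move=> g; apply: le_trans (ler_norm_sum _ _ _) _; apply: ler_sum => i _.
  by rewrite normrM ler_piMr// indicE; case: (_ \in _); rewrite ?normr1 ?normr0.
- move=> g nAg; apply: big1 => i _; rewrite indicE memNset ?mulr0// => Aig.
  by apply: nAg; rewrite (bigD1 i)//=; left.
- elim/big_ind : _ => [|B C Bfin Cfin|i _]; last exact: Afin.
    by rewrite /wmu esum_set0 ltry.
  by apply: le_lt_trans (wmuU_le hw _ _) _; exact: lte_add_pinfty.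
Qed.

(* Compensates the factor lost in the quasi-triangle inequality [weak_boundD]. *)
Let share (eta : R) := eta / (2 * 2 `^ p).

Let share_gt0 eta : 0 < eta -> 0 < share eta.
Proof. by move=> ?; rewrite divr_gt0// mulr_gt0// powR_gt0. Qed.

Let shareK eta : 2 `^ p * (share eta + share eta) = eta.
Proof. by rewrite /share; field; rewrite gt_eqF// powR_gt0. Qed.

Let share_le eta : 0 < eta -> share eta + share eta <= eta.
Proof.
move=> eta0; rewrite -[leRHS]shareK ler_peMl//.
  by rewrite addr_ge0// ltW// share_gt0.
have : 2 `^ 0 <= 2 `^ p by rewrite ler_powR ?ler1n// ltW.
by rewrite powRr0.
Qed.

(** Approximate [f] by a simple [h]. Removing a finite set leaves the support of [h] with small
    measure, so the tail of the bounded function [h] is small, and so is that of [f]. *)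
Lemma mpinf_tail (f : G -> R) (eta : R) : in_mpinf w p f -> 0 < eta ->
  exists2 H : set G, finite_set H & weak_bound w p (cutoff (~` H) f) eta.
Proof.
move=> [_ approx] eta0; have share0 := share_gt0 eta0.
have e0 : 0 < share eta `^ p^-1 by rewrite powR_gt0.
have [h [/simple_fm_bounded[M [A [M0 hM hA Afin]]] /ltW fh]] := approx _ e0.
move/(wknorm_weak_bound hw p0 _ (ltW e0)) : fh.
rewrite -powRrM mulVf ?gt_eqF// powRr1 ?(ltW share0)// => fh.
(* The [+ 1] keeps the divisor positive when [M = 0]. *)
have Mp : 0 < M `^ p + 1 by rewrite ltr_wpDl ?powR_ge0.
have [H Hfin AH] := wmu_finite_approx hw Afin (divr_gt0 share0 Mp).
exists H => //.
have hH : weak_bound w p (cutoff (~` H) h) (share eta).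
  apply: (weak_bound_le hw (h := cutoff (~` H) h)
    (K := M `^ p * (share eta / (M `^ p + 1)))) => //.
    rewrite mulrA ler_pdivrMr// mulrC ler_wpM2l ?ltW//; lra.
  apply: (weak_bound_bounded hw p0 _ _ AH) => g.
    have [Hg|Hg] := pselect ((~` H) g); first by rewrite cutoff_in.
    by rewrite cutoff_out// normr0.
  have [Hg nA|Hg _] := pselect ((~` H) g); last by rewrite cutoff_out.
  by rewrite cutoff_in// hA// => Ag; apply: nA; split.
have fhH : weak_bound w p (cutoff (~` H) (fun g => f g - h g)) (share eta).
  apply: weak_bound_le fh => // g.
  have [Hg|Hg] := pselect ((~` H) g); first by rewrite cutoff_in.
  by rewrite cutoff_out// normr0.
rewrite -[eta]shareK; apply: weak_bound_le (weak_boundD hw fhH hH) => // g.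
have [Hg|Hg] := pselect ((~` H) g); last by rewrite cutoff_out// normr0.
by rewrite !cutoff_in// subrK.
Qed.

(** The point [g] lies in the level set at [|f g| / 2], so [w g] is at most the measure of that set.
    The factor 2 appears because level sets are defined by a strict inequality. *)
Lemma weak_bound_point (f : G -> R) (K : R) g : 0 <= K ->
  weak_bound w p f (K `^ p) -> `|f g| <= K * (2 * w g `^ (- p^-1)).
Proof.
move=> K0 fK; have [->|fg0] := eqVneq (f g) 0.
  by rewrite normr0 !mulr_ge0// powR_ge0.
have c0 : 0 < `|f g| / 2 by rewrite divr_gt0 ?normr_gt0.
have /le_trans /(_ (fK _ c0)) : ((w g)%:E <= wmu w (levset f (`|f g| / 2)))%E.
  have -> : (w g)%:E = wmu w [set g] by rewrite /wmu esum_set1// lee_fin ltW.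
  by apply: (le_wmu hw) => _ -> /=; rewrite /levset/=; lra.
rewrite lee_fin ler_pdivlMr ?powR_gt0// mulrC -ler_pdivlMr// => le.
suff : `|f g| / 2 <= K * w g `^ (- p^-1) by lra.
rewrite leNgt; apply/negP => lt.
have : (K * w g `^ (- p^-1)) `^ p < (`|f g| / 2) `^ p.
  by rewrite gt0_ltr_powR ?nnegrE ?mulr_ge0 ?powR_ge0 ?divr_ge0.
rewrite powRM ?powR_ge0// -powRrM mulNr mulVf ?gt_eqF// powR_inv1 ?ltW//.
by rewrite ltNge le.
Qed.

(** * The gliding hump *)

Section Blocks.
Variable x : nat -> G -> R.
Hypothesis x_cvg0 : forall g (eps : R), 0 < eps ->
  exists m, forall n, (m <= n)%N -> `|x n g| <= eps.
Hypothesis x_tail : forall n (eta : R), 0 < eta ->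
  exists2 H : set G, finite_set H & weak_bound w p (cutoff (~` H) (x n)) eta.

Lemma x_uniform_cvg0 (F : set G) (eps : R) : finite_set F -> 0 < eps ->
  exists m, forall n, (m <= n)%N -> forall g, F g -> `|x n g| <= eps.
Proof.
move=> /finite_seqP[r ->] eps0; elim: r => [|h r [m IH]]; first by exists 0%N.
have [m' xm'] := x_cvg0 h eps0.
exists (maxn m m') => n; rewrite geq_max => /andP[mn m'n] g /=.
by rewrite inE => /predU1P[->|gr]; [exact: xm'|exact: IH].
Qed.

(** Take [D] to be a finite set carrying [x n] up to [eta / 2], with [F] removed. For large [n] the
    values on [F] are uniformly small, and [F] has finite measure, so the removal costs another
    [eta / 2]. *)
Lemma block_exists (F : set G) (eta : R) : finite_set F -> 0 < eta ->
  exists m, forall n, (m <= n)%N -> exists D : set G, [/\ finite_set D,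
    forall g, D g -> ~ F g & weak_bound w p (cutoff (~` D) (x n)) eta].
Proof.
move=> Ffin eta0; have eta20 : 0 < eta / 2 by rewrite divr_gt0.
have muF : wmu w F = (fine (wmu w F))%:E.
  by rewrite fineK// ge0_fin_numE ?wmu_ge0// wmu_finite.
set u := fine _ in muF.
have u0 : 0 <= u by rewrite fine_ge0// wmu_ge0.
pose e := (eta / 2 / (u + 1)) `^ p^-1.
have u1 : 0 < u + 1 by lra.
have eu0 : 0 < eta / 2 / (u + 1) by rewrite divr_gt0.
have e0 : 0 < e by rewrite powR_gt0.
have [m xm] := x_uniform_cvg0 Ffin e0.
exists m => n /xm xn.
have [H Hfin xH] := x_tail n eta20.
exists (H `\` F); split.
- exact: finite_setD.
- by move=> g [].
have xF : weak_bound w p (cutoff F (x n)) (eta / 2).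
  have muFu : (wmu w F <= u%:E)%E by rewrite muF.
  apply: weak_bound_le (weak_bound_bounded hw p0 (M := e) _ _ muFu) => //.
  - rewrite /e -powRrM mulVf ?gt_eqF// powRr1 ?(ltW eu0)//.
    by rewrite mulrAC ler_pdivrMr// ler_wpM2l ?ltW//; lra.
  - move=> g; have [Fg|Fg] := pselect (F g); first by rewrite cutoff_in// xn.
    by rewrite cutoff_out// normr0 ltW.
  - by move=> g Fg; rewrite cutoff_out.
(* Restrictions of one function are compared at the same level [c], so the bounds add without the
   factor [2 ^ p]. *)
rewrite [eta]splitr; apply: weak_bound_levsetU xH xF => // c c0.
rewrite !levset_cutoff// => g [cg nD].
have [Fg|Fg] := pselect (F g); [right|left] => //; split => // Hg.
exact: nD.
Qed.

(* The partial sums of a subsequence of [x] stay close to sums [s] of disjoint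
   finite blocks; [Q k eta s] is the invariant carried by the choice of blocks. *)
Lemma gliding_hump (Q : nat -> R -> (G -> R) -> Prop) :
  (forall eta, 0 < eta -> Q 0%N eta (fun=> 0)) ->
  (forall k eta eta' s (F : set G), 0 < eta' -> eta' + eta' <= eta ->
    finite_set F -> (forall g, ~ F g -> s g = 0) -> Q k eta' s ->
    forall m, exists2 n, (m <= n)%N & forall D : set G,
      (forall g, s g = 0 \/ cutoff D (x n) g = 0) ->
      weak_bound w p (cutoff (~` D) (x n)) eta' ->
      Q k.+1 eta (fun g => s g + cutoff D (x n) g)) ->
  forall k eta, 0 < eta -> exists l : seq nat, [/\ uniq l, size l = k &
    exists s : G -> R, Q k eta s /\
      weak_bound w p (fun g => \sum_(i <- l) x i g - s g) eta].
Proof.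
move=> Q0 QS k eta eta0.
(* The induction also carries a finite set [F] supporting [s], which the next block has to avoid. *)
suff [l [ul sl [s [F [_ _ Qs ls]]]]] : exists l : seq nat, [/\ uniq l, size l = k &
    exists (s : G -> R) (F : set G), [/\ finite_set F,
      forall g, ~ F g -> s g = 0, Q k eta s &
      weak_bound w p (fun g => \sum_(i <- l) x i g - s g) eta]].
  by exists l; split=> //; exists s.
elim: k eta eta0 => [|k IH] eta eta0.
  exists [::]; split => //; exists (fun=> 0), set0; split => //; first exact: Q0.
  apply: weak_bound_le (weak_bound_bounded hw p0 (f := fun=> 0) (A := set0)
    (M := 0) (eta := 0) _ _ _) => //.
  - by move=> g; rewrite big_nil subr0.
  - by rewrite mulr0 ltW.
  - by move=> g; rewrite normr0.
  - by rewrite /wmu esum_set0.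
have share0 := share_gt0 eta0; have sharele := share_le eta0.
have [l [ul sl [s [F [Ffin sF Qs ls]]]]] := IH _ share0.
have [m hm] := block_exists Ffin share0.
(* The index [n] is past the threshold for a good block and past every entry of [l], which keeps the
   list duplicate-free. *)
have [n mn Qn] := QS _ _ _ _ _ share0 sharele Ffin sF Qs (maxn m (\max_(i <- l) i).+1).
have [D [Dfin DF xD]] := hm _ (leq_trans (leq_maxl _ _) mn).
have nl : n \notin l.
  apply/negP => nl; have := leq_trans (leq_maxr _ _) mn.
  by rewrite ltnNge (leq_bigmax_seq _ (F := id)).
have sD g : s g = 0 \/ cutoff D (x n) g = 0.
  have [Fg|nFg] := pselect (F g); last by left; exact: sF.
  by right; rewrite cutoff_out// => /DF.
exists (n :: l); split => /=; [by rewrite nl|by rewrite sl|].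
exists (fun g => s g + cutoff D (x n) g), (F `|` D); split.
- by rewrite finite_setU.
- move=> g /not_orP[nF nD]; by rewrite sF// cutoff_out// addr0.
- exact: Qn.
rewrite -[eta]shareK; apply: weak_bound_le (weak_boundD hw ls xD) => // g.
rewrite big_cons -{1}(cutoffC_add D (x n)).
by rewrite le_eqVlt; apply/orP; left; apply/eqP; congr Num.norm; ring.
Qed.

End Blocks.
End Simple.

(** * No sequence of this kind has sums of order [sqrt k] *)

Section Sequence.
Local Set Implicit Arguments. Local Unset Strict Implicit.
Local Open Scope classical_set_scope.
Context {R : realType} {G : choiceType} {w : G -> R} {p : R}.
Hypothesis hw : forall g, 0 < w g.
Hypothesis p0 : 0 < p.

Lemma finite_support_bounded (s : G -> R) (F : set G) : finite_set F ->
  (forall g, ~ F g -> s g = 0) -> exists2 M, 0 <= M & forall g, `|s g| <= M.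
Proof.
move=> /finite_seqP[r ->] sr; exists (\sum_(i <- r) `|s i|); first exact: sumr_ge0.
move=> g; have [gr|/negP/sr ->] := boolP (g \in r); last first.
  by rewrite normr0 sumr_ge0.
by rewrite (big_rem g)//= lerDl sumr_ge0.
Qed.

(* The measure of [levset s c] is negligible against [c `^ - p] unless [c] lies
   in a compact interval of (0, oo), on which the smallness of [f] at the lower
   end makes [f] negligible; so at each [c] only one of the two terms counts. *)
Lemma weak_bound_separate (s : G -> R) (F : set G) (K eps : R) :
  finite_set F -> (forall g, ~ F g -> s g = 0) -> weak_bound w p s K -> 0 < eps ->
  exists alpha delta, [/\ 0 < alpha, 0 < delta & forall f,
    (wmu w (levset f alpha) <= delta%:E)%E -> weak_bound w p f K ->
    (forall g, s g = 0 \/ f g = 0) ->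
    weak_bound w p (fun g => s g + f g) (K + eps)].
Proof.
move=> Ffin sF sK eps0.
have [M M0 sM] := finite_support_bounded Ffin sF.
have muF : wmu w F = (fine (wmu w F))%:E.
  by rewrite fineK// ge0_fin_numE ?wmu_ge0// wmu_finite.
set u := fine _ in muF.
have u0 : 0 <= u by rewrite fine_ge0// wmu_ge0.
have u1 : 0 < u + 1 by lra.
have eu0 : 0 < eps / (u + 1) by rewrite divr_gt0.
set alpha := (eps / (u + 1)) `^ p^-1.
have a0 : 0 < alpha by rewrite powR_gt0.
have apE : alpha `^ p = eps / (u + 1).
  by rewrite -powRrM mulVf ?gt_eqF// powRr1 ?(ltW eu0).
have b0 : 0 < M + alpha by rewrite ltr_wpDl.
(* Below [alpha] the whole support of [s] costs at most [eps / c ^ p]; from [M + alpha] on, [s] has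
   empty level sets; in between, [delta] is the allowance at the upper end, where it is smallest. *)
exists alpha, (eps / (M + alpha) `^ p); split => //.
  by rewrite divr_gt0// powR_gt0.
move=> f fa fK sf c c0; rewrite (wmu_levset_disjoint hw c0 sf) mulrDl EFinD.
have powle d e : 0 < d -> d <= e -> eps / e `^ p <= eps / d `^ p.
  move=> d0 de; rewrite ler_pM2l// lef_pV2 ?posrE ?powR_gt0//.
    by rewrite ge0_ler_powR ?nnegrE// ltW// (lt_le_trans d0).
  by rewrite (lt_le_trans d0).
have [ca|ac] := ltP c alpha.
  rewrite [leRHS]addeC leeD ?fK//.
  apply: (@le_trans _ _ (wmu w F)).
    apply: (le_wmu hw) => g /= cs; apply: contrapT => /sF s0.
    by move: cs; rewrite /levset/= s0 normr0 ltNge ltW.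
  rewrite muF lee_fin; apply: le_trans (powle _ _ c0 (ltW ca)).
  by rewrite apE ler_pdivlMr ?divr_gt0// mulrA ler_pdivrMr//; nra.
have [cb|bc] := ltP c (M + alpha).
  rewrite leeD ?sK//.
  apply: (@le_trans _ _ (eps / (M + alpha) `^ p)%:E); last first.
    by rewrite lee_fin powle// ltW.
  apply: le_trans fa; apply: (le_wmu hw) => g; rewrite /levset/=.
  exact: le_lt_trans.
rewrite [leRHS]addeC leeD ?fK//.
have -> : levset s c = set0.
  apply/seteqP; split => g //; rewrite /levset/= => cs.
  by have := sM g; lra.
by rewrite /wmu esum_set0 lee_fin divr_ge0 ?powR_ge0 ?ltW.
Qed.

(** What remains of the embedding once it is restricted to unit vectors. Bounds are [p]-th powers of
    norms, so [sqrt k] becomes [k ^ (p / 2)]. *)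
Lemma no_l2_sequence (x : nat -> G -> R) (A B : R) : p != 2 ->
  (forall g (eps : R), 0 < eps ->
    exists m, forall n, (m <= n)%N -> `|x n g| <= eps) ->
  (forall n (eta : R), 0 < eta ->
    exists2 H : set G, finite_set H & weak_bound w p (cutoff (~` H) (x n)) eta) ->
  0 < A -> 0 < B ->
  (forall l : seq nat, uniq l ->
    weak_bound w p (fun g => \sum_(i <- l) x i g) (B * (size l)%:R `^ (p / 2))) ->
  (forall (l : seq nat) K, uniq l -> 0 <= K ->
    weak_bound w p (fun g => \sum_(i <- l) x i g) K ->
    A * (size l)%:R `^ (p / 2) <= K) ->
  False.
Proof.
move=> p2 x_cvg0 x_tail A0 B0 upper lower.
have xB n : weak_bound w p (x n) B.
  have := upper [:: n] isT; rewrite /= powR1 mulr1.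
  by apply: weak_bound_le => // g; rewrite big_seq1.
have cut_xB n D : weak_bound w p (cutoff D (x n)) B.
  apply: weak_bound_le (xB n) => // g.
  have [Dg|Dg] := pselect (D g); first by rewrite cutoff_in.
  by rewrite cutoff_out// normr0.
have pow2 : 0 < 2 `^ p by rewrite powR_gt0.
have zero_bound K : 0 <= K -> weak_bound w p (fun=> 0) K.
  move=> K0; apply: weak_bound_le (weak_bound_bounded hw p0 (f := fun=> 0)
    (A := set0) (M := 0) (eta := 0) _ _ _) => //.
  - by rewrite mulr0.
  - by move=> g; rewrite normr0.
  - by rewrite /wmu esum_set0.
(* Transfers the lower estimate from a sum of terms to the nearby sum of blocks. *)
have block_lower l s K eta : uniq l -> 0 <= K -> 0 <= eta -> weak_bound w p s K ->
    weak_bound w p (fun g => \sum_(i <- l) x i g - s g) eta ->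
    A * (size l)%:R `^ (p / 2) <= 2 `^ p * (K + eta).
  move=> ul K0 eta0 sK rest; apply: lower => //.
    by rewrite mulr_ge0 ?addr_ge0// ltW.
  apply: weak_bound_le (weak_boundD hw sK rest) => // g.
  by rewrite addrC subrK.
have [p_lt2|p_gt2|/eqP] := ltgtP p 2; last by rewrite (negbTE p2).
- have [[c [delta [c0 delta0 often]]]|rare] := pselect (exists c delta,
    [/\ 0 < c, 0 < delta & forall m, exists2 n, (m <= n)%N &
      (delta%:E < wmu w (levset (x n) c))%E]).
  + (* Infinitely many terms are large at a common level: [s] has measure of
       order [k] there, more than the order [k `^ (p / 2)] that is allowed. *)
    have cp0 : 0 < c `^ p by rewrite powR_gt0.
    (* With error at most [eta0], the part of [x n] off its block has measure at most [delta / 2] at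
       level [c], so the block keeps at least [delta / 2]. *)
    pose eta0 := c `^ p * (delta / 2).
    have eta00 : 0 < eta0 by rewrite mulr_gt0// divr_gt0.
    (* The guard makes the invariant vacuous for large tolerances, since [gliding_hump] asks for the
       inductive step at every [eta]. *)
    pose Q (k : nat) (eta : R) (s : G -> R) := eta <= eta0 ->
      ((k%:R * (delta / 2))%:E <= wmu w (levset s c))%E.
    apply: (@powR_growth R (p / 2) 1 (delta / 2)
      (2 `^ p * (B + eta0) / c `^ p)); [lra|by rewrite divr_gt0|].
    move=> k k0.
    have [|k1 eta eta' s F eta'0 eta'2 _ _ Qs m|l [ul sl [s [Qs rest]]]] :=
        gliding_hump hw p0 x_cvg0 x_tail (Q := Q) _ _ k eta00.
    * by move=> eta _ _; rewrite mul0r wmu_ge0.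
    * have [n mn xn] := often m; exists n => // D sD xD eta_le.
      rewrite (wmu_levset_disjoint hw c0 sD) -natr1 mulrDl mul1r EFinD.
      have eta'_le : eta' <= eta0 by lra.
      apply: leeD; first exact: Qs.
      have rest : (wmu w (levset (cutoff (~` D) (x n)) c) <= (delta / 2)%:E)%E.
        apply: le_trans (xD c c0) _.
        by rewrite lee_fin ler_pdivrMr// mulrC.
      move: xn; rewrite -{1}(cutoffC_add D (x n)) (wmu_levset_disjoint hw c0).
        move: rest; have := wmu_ge0 hw (levset (cutoff (~` D) (x n)) c).
        case: (wmu w (levset (cutoff (~` D) (x n)) c)) => [v| |]//.
        have := wmu_ge0 hw (levset (cutoff D (x n)) c).
        case: (wmu w (levset (cutoff D (x n)) c)) => [v'| |]//.
          by rewrite -EFinD lte_fin !lee_fin => *; lra.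
        by move=> *; rewrite leey.
      move=> g; have [Dg|Dg] := pselect (D g); last by left; rewrite cutoff_out.
      by right; rewrite cutoff_out.
    have rest' : weak_bound w p (fun g => s g - \sum_(i <- l) x i g) eta0.
      by apply: weak_bound_le rest => // g; rewrite distrC.
    have := weak_boundD hw (upper l ul) rest' c0.
    under [levset _ _]eq_set do rewrite addrC subrK.
    move=> /(le_trans (Qs (lexx _))); rewrite lee_fin sl.
    (* Lets the constant error [eta0] be absorbed into a multiple of [k ^ (p / 2)]. *)
    have kp : 1 <= k%:R `^ (p / 2) :> R.
      have : 1 `^ (p / 2) <= k%:R `^ (p / 2) :> R.
        by rewrite ge0_ler_powR ?nnegrE ?ler1n ?ler0n// divr_ge0// ltW.
      by rewrite powR1.
    rewrite powRr1 ?ler0n// [_ * (delta / 2)]mulrC => /le_trans; apply.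
    rewrite [leRHS]mulrAC ler_pM2r ?invr_gt0// -mulrA ler_pM2l// mulrDl lerD2l.
    by rewrite ler_peMr// ltW.
  + (* Measures at each level tend to 0: blocks at separate levels stay bounded. *)
    (* A new block raises [B + eta'] by [eta'] only, and [eta' + eta' <= eta]; the final bound is
       [B + 1] for every [k]. *)
    pose Q (k : nat) (eta : R) (s : G -> R) := weak_bound w p s (B + eta).
    apply: (@powR_growth R 0 (p / 2) A (2 `^ p * (B + 1 + 1))) => //.
      by rewrite divr_gt0.
    move=> k k0.
    have [|k1 eta eta' s F eta'0 eta'2 Ffin sF Qs m|l [ul sl [s [Qs rest]]]] :=
        gliding_hump hw p0 x_cvg0 x_tail (Q := Q) _ _ k ltr01.
    * by move=> eta eta0; apply: zero_bound; lra.
    * have [alpha [delta [alpha0 delta0 sep]]] :=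
        weak_bound_separate Ffin sF Qs eta'0.
      have [n mn xn] : exists2 n, (m <= n)%N &
          (wmu w (levset (x n) alpha) <= delta%:E)%E.
        apply: contrapT => no; apply: rare; exists alpha, delta; split => // m'.
        exists (maxn m m'); rewrite ?leq_maxr// ltNge; apply/negP => le.
        by apply: no; exists (maxn m m'); rewrite ?leq_maxl.
      exists n => // D sD _; rewrite /Q.
      have bound : weak_bound w p (cutoff D (x n)) (B + eta').
        by apply: weak_bound_le (cut_xB n D) => //; rewrite lerDl ltW.
      apply: weak_bound_le (sep _ _ bound sD) => //; first lra.
      apply: le_trans xn; apply: (le_wmu hw).
      by rewrite levset_cutoff//; exact: subIsetl.
    rewrite powRr0 mulr1 -sl; apply: block_lower ul _ _ Qs rest => //; lra.
- (* The upper p-estimate for disjoint functions gives norm of order [k `^ p^-1]. *)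
  pose Q (k : nat) (eta : R) (s : G -> R) := weak_bound w p s (k%:R * B).
  apply: (@powR_growth R 1 (p / 2) A (2 `^ p * (B + 1))) => //; first lra.
  move=> k k0.
  have [|k1 eta eta' s F eta'0 eta'2 Ffin sF Qs m|l [ul sl [s [Qs rest]]]] :=
      gliding_hump hw p0 x_cvg0 x_tail (Q := Q) _ _ k ltr01.
  + by move=> eta eta0; apply: zero_bound; rewrite mul0r.
  + exists m => // D sD xD c c0; rewrite (wmu_levset_disjoint hw c0 sD).
    by rewrite -natr1 !mulrDl mul1r EFinD leeD// ?Qs// cut_xB.
  rewrite powRr1 ?ler0n//.
  have := block_lower _ _ _ _ ul _ ler01 Qs rest.
  rewrite sl => /(_ (mulr_ge0 (ler0n _ _) (ltW B0)))/le_trans; apply.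
  rewrite -mulrA ler_pM2l// mulrDl mul1r mulrC lerD2l ler1n//.
Qed.
End Sequence.

(** * Finitely supported vectors of [l2] and the images of the unit vectors *)

Lemma l2sq_add {R : realType} (y : nat -> R) (n : nat) (t : R) : y n = 0 ->
  l2sq (fun k => t * (k == n)%:R + y k) = ((t ^+ 2)%:E + l2sq y)%E.
Proof.
move=> yn0; rewrite /l2sq.
(* Written as a sum concentrated at [n], the new term can be added to [l2sq y] index by index. *)
have -> : (t ^+ 2)%:E = (\esum_(k in [set: nat]) (t ^+ 2 * (k == n)%:R)%:E)%E.
  rewrite (esumID [set n]) => [|k _]; last by rewrite lee_fin mulr_ge0 ?sqr_ge0.
  rewrite !setTI esum_set1 ?eqxx ?mulr1 ?lee_fin ?sqr_ge0//.
  by rewrite esum1 ?adde0// => k /eqP/negbTE ->; rewrite mulr0.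
rewrite -esumD => [|k _|k _]; first last.
- by rewrite lee_fin sqr_ge0.
- by rewrite lee_fin mulr_ge0 ?sqr_ge0.
apply: eq_esum => k _; rewrite -EFinD; congr (_%:E).
by have [->|_] := eqVneq k n; rewrite ?yn0 ?mulr1n ?mulr0n; ring.
Qed.

Section Embedding.
Import numFieldNormedType.Exports.
Local Set Implicit Arguments. Local Unset Strict Implicit.
Local Open Scope classical_set_scope.
Context {R : realType} {G : choiceType} {w : G -> R} {p : R}.
Hypothesis hw : forall g, 0 < w g.
Hypothesis p0 : 0 < p.
Variables (T : (nat -> R) -> (G -> R)) (a b : R).
Hypotheses (a0 : 0 < a) (b0 : 0 < b).
Hypothesis T_linear : forall (r : R) (x y : nat -> R), in_l2 x -> in_l2 y ->
  T (fun k => r * x k + y k) = (fun g => r * T x g + T y g).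
Hypothesis T_mpinf : forall x, in_l2 x -> in_mpinf w p (T x).
Hypothesis T_norm : forall x, in_l2 x ->
  ((a * l2norm x)%:E <= wknorm w p (T x))%E /\
  (wknorm w p (T x) <= (b * l2norm x)%:E)%E.

Let unit_vec (n : nat) : nat -> R := fun k => (k == n)%:R.
Let vec (l : seq nat) (t : nat -> R) : nat -> R := fun k => if k \in l then t k else 0.

Let zero : nat -> R := fun=> 0.

Let l2sq0 : l2sq zero = 0%E.
Proof. by rewrite /l2sq esum1// => k _; rewrite expr0n. Qed.

Let unit_vec_l2 n : in_l2 (unit_vec n).
Proof.
have := l2sq_add zero n 1 erefl; rewrite l2sq0 adde0 /in_l2.
rewrite (_ : (fun k => _) = unit_vec n) => [->|]; first exact: ltry.
by apply/funext => k; rewrite mul1r addr0.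
Qed.

(** Both halves go through one induction: linearity of [T] needs the shorter vector to be in [l2],
    which the first half provides. *)
Let vecE l t : uniq l -> l2sq (vec l t) = (\sum_(i <- l) t i ^+ 2)%:E /\
  T (vec l t) = fun g => \sum_(i <- l) t i * T (unit_vec i) g.
Proof.
have vec0 : vec [::] t = zero by apply/funext.
elim: l => [_|n l IH /= /andP[nl ul]].
  have zero_l2 : in_l2 zero by rewrite /in_l2 l2sq0 ltry.
  rewrite vec0 l2sq0 big_nil; split => //.
  (* Linearity with [r = 1] gives [T 0 = T 0 + T 0], hence [T 0 = 0]. *)
  have := T_linear 1 zero_l2 zero_l2.
  rewrite (_ : (fun k => _) = zero); last by apply/funext => k; rewrite mulr0 addr0.
  move=> /(congr1 (fun f => f _)) T0; apply/funext => g; rewrite big_nil.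
  by have := T0 g; lra.
have [sqE TE] := IH ul.
have vecS : vec (n :: l) t = fun k => t n * unit_vec n k + vec l t k.
  apply/funext => k; rewrite /vec /unit_vec inE.
  by have [->|_] := eqVneq k n; rewrite /= ?(negbTE nl) ?mulr1 ?mulr0 ?addr0 ?add0r.
rewrite vecS; split.
  by rewrite l2sq_add ?sqE ?big_cons// /vec (negbTE nl).
rewrite T_linear//; last by rewrite /in_l2 sqE ltry.
by apply/funext => g; rewrite TE big_cons.
Qed.

Let vec_l2 l t : uniq l -> in_l2 (vec l t).
Proof. by move=> ul; rewrite /in_l2 (vecE t ul).1 ltry. Qed.

Let vec_norm l t : uniq l -> l2norm (vec l t) = Num.sqrt (\sum_(i <- l) t i ^+ 2).
Proof. by move=> ul; rewrite /l2norm (vecE t ul).1. Qed.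

Let T_weak_bound x : in_l2 x -> weak_bound w p (T x) ((b * l2norm x) `^ p).
Proof.
move=> x2; apply/(wknorm_weak_bound hw p0); last exact: (T_norm x2).2.
by rewrite mulr_ge0 ?sqrtr_ge0// ltW.
Qed.

(** Evaluation at [g] after [T] is a bounded functional on [l2], so its coefficients are
    square-summable and tend to 0. *)
Lemma image_cvg0 g (eps : R) : 0 < eps ->
  exists m, forall n, (m <= n)%N -> `|T (unit_vec n) g| <= eps.
Proof.
move=> eps0; pose u n : R := T (unit_vec n) g ^+ 2.
pose C := b * (2 * w g `^ (- p^-1)).
have C0 : 0 <= C by rewrite !mulr_ge0 ?powR_ge0// ltW.
have bound n : series u n <= C ^+ 2.
  (* Testing the functional on its own first [n] coefficients gives [S <= C * sqrt S], hence
     [S <= C ^ 2]. *)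
  rewrite /series/=; pose t k := T (unit_vec k) g.
  have ul : uniq (index_iota 0 n) by exact: iota_uniq.
  have := weak_bound_point hw p0 g _ (T_weak_bound (vec_l2 t ul)).
  rewrite mulr_ge0 ?sqrtr_ge0 ?(ltW b0)// => /(_ isT).
  rewrite (vec_norm t ul) (vecE t ul).2.
  set S := \sum_(0 <= i < n) u i.
  rewrite -[X in `|X|]/S -[X in Num.sqrt X]/S.
  have S0 : 0 <= S by apply: sumr_ge0 => i _; rewrite sqr_ge0.
  rewrite ger0_norm// mulrAC -/C -{1}(sqr_sqrtr S0) expr2.
  have [s0|s0] := eqVneq (Num.sqrt S) 0.
    by rewrite -[S]sqr_sqrtr// s0 expr0n exprn_ge0.
  rewrite ler_pM2r ?lt0r ?s0 ?sqrtr_ge0// => le.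
  by rewrite -[S]sqr_sqrtr// lerXn2r ?nnegrE ?sqrtr_ge0.
have u_cvg : cvgn (series u).
  apply: nondecreasing_is_cvgn.
    by apply/nondecreasing_seqP => n; rewrite seriesSr lerDl sqr_ge0.
  by exists (C ^+ 2) => _ [n _ <-].
have /cvgrPdist_le/(_ _ (exprn_gt0 2 eps0))[m _ um] := cvg_series_cvg_0 u_cvg.
exists m => n /um /=; rewrite sub0r normrN ger0_norm ?sqr_ge0// /u.
rewrite -[_ ^+ 2]ger0_norm ?sqr_ge0// normrX => le.
by rewrite -(ler_pXn2r (n := 2))// ?nnegrE// ltW.
Qed.

Lemma embedding_absurd : p != 2 -> False.
Proof.
move=> p2.
have norm1 l : uniq l -> l2norm (vec l (fun=> 1)) = (size l)%:R `^ 2^-1.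
  move=> ul; rewrite vec_norm// powR12_sqrt ?ler0n//; congr Num.sqrt.
  by under eq_bigr do rewrite expr1n; rewrite big_const_seq count_predT iter_addr_0.
have sum1 l : uniq l ->
    T (vec l (fun=> 1)) = fun g => \sum_(i <- l) T (unit_vec i) g.
  move=> ul; rewrite (vecE _ ul).2; apply/funext => g.
  by under eq_bigr do rewrite mul1r.
have powE c l : 0 < c -> (c * (size l)%:R `^ 2^-1) `^ p =
    c `^ p * (size l : nat)%:R `^ (p / 2) :> R.
  by move=> c0; rewrite powRM ?powR_ge0 ?(ltW c0)// -powRrM [2^-1 * p]mulrC.
apply: (no_l2_sequence hw p0 (x := fun n => T (unit_vec n))
  (A := a `^ p) (B := b `^ p)) => //; rewrite ?powR_gt0//.
- exact: image_cvg0.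
- by move=> n eta eta0; apply: (mpinf_tail hw p0) => //; exact: T_mpinf.
- move=> l ul; rewrite -powE// -sum1// -norm1//; apply: T_weak_bound.
  exact: vec_l2.
- move=> l K ul K0; rewrite -sum1// => bnd.
  (* As a [p]-th power, [K] fits [wknorm_weak_bound], which turns the weak bound into a norm
     bound. *)
  have KE : K = (K `^ p^-1) `^ p by rewrite -powRrM mulVf ?gt_eqF// powRr1.
  move: bnd; rewrite {1}KE => /(wknorm_weak_bound hw p0 _ (powR_ge0 _ _)).
  move=> /(le_trans (T_norm (vec_l2 (fun=> 1) ul)).1).
  rewrite lee_fin norm1// => le; rewrite KE -powE//.
  by rewrite ge0_ler_powR ?nnegrE ?mulr_ge0 ?powR_ge0// ltW.
Qed.
End Embedding.

Theorem theorem13 (R : realType) (G : choiceType) (w : G -> R)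
  (hw : forall g, 0 < w g) (p : R) (hp1 : 1 < p) (hp2 : p != 2) :
  ~ embeds_l2_into_mpinf w p.
Proof.
move=> [T [a [b [a0 [b0 [T_lin [T_m T_norm]]]]]]].
exact: (embedding_absurd hw (lt_trans ltr01 hp1) a0 b0 T_lin T_m T_norm hp2).
Qed.
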